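(* Let $d\ge 1$ and let $A=(A_{ijkl})_{1\le i,j,k,l\le d}$ be a real 4-leg tensor that satisfies the diagonal reflection symmetry along both axes $l_1$ and $l_2$, i.e. for all $i,j,k,l$, $$A_{ijkl}=A_{klij}\quad(\text{reflection along } l_1),\qquad A_{ijkl}=A_{jilk}\quad(\text{reflection along } l_2).$$ Let $1\le\chi\le d^2$. Then the symmetric SVD splitting of $A$ along the $l_1$ axis with bond dimension $\chi$ can be chosen so that its 3-leg tensor $v_\Lambda$ has the following symmetry: there exists a diagonal $\chi\times\chi$ matrix $g'$ with every diagonal entry equal to $+1$ or $-1$ such that $$(v_\Lambda)_{ji\alpha}=(v_\Lambda)_{ij\alpha}\,g'_{\alpha\alpha}\qquad\text{for all } 1\le i,j\le d,\ 1\le\alpha\le\chi .$$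
   Context: The tensor $A$ sits on a site of a square lattice, with four legs (right, up, left, down), all of the same dimension $d$. The axes $l_1,l_2$ are the two diagonal lines through the site. The axis $l_1$ separates the four legs into two pairs, and $A_{ijkl}$ is written so that $(i,j)$ are the two legs on one side of $l_1$ and $(k,l)$ the two legs on the other side, with reflection across $l_1$ exchanging $i\leftrightarrow k$ and $j\leftrightarrow l$, and reflection across $l_2$ exchanging $i\leftrightarrow j$ and $k\leftrightarrow l$. Symmetric SVD splitting along $l_1$ with bond dimension $\chi$: regard $A$ as the $d^2\times d^2$ matrix $M_{(ij),(kl)}=A_{ijkl}$, which is real symmetric by the reflection symmetry along $l_1$. Choose an orthonormal basis of real eigenvectors of $M$, ordered so that the absolute values of the eigenvalues are non-increasing, $|\lambda_1|\ge|\lambda_2|\ge\cdots\ge|\lambda_{d^2}|$, and keep the first $\chi$ of them. Let $v_{ij\alpha}$ ($1\le\alpha\le\chi$) be the $(ij)$ component of the $\alpha$-th eigenvector and $\Lambda=\mathrm{diag}(\lambda_1,\dots,\lambda_\chi)$. Define $$(v_\Lambda)_{ij\alpha}=v_{ij\alpha}\sqrt{|\lambda_\alpha|},\qquad \sigma'=\operatorname{sign}\Lambda=\mathrm{diag}(\operatorname{sign}\lambda_1,\dots,\operatorname{sign}\lambda_\chi)$$ (the sign assigned to a zero eigenvalue is immaterial). The (truncated) splitting is $$A_{ijkl}\approx\sum_{\alpha=1}^{\chi}(v_\Lambda)_{ij\alpha}\,\sigma'_{\alpha\alpha}\,(v_\Lambda)_{kl\alpha}.$$ ''Can be chosen'' means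 that there is a choice of an orthonormal basis of real eigenvectors of $M$, ordered so that $|\lambda_1|\ge|\lambda_2|\ge\cdots\ge|\lambda_{d^2}|$, for which the conclusion holds. *)

(* Defs.v *)
From mathcomp Require Import all_boot all_order all_algebra.
From mathcomp Require Import reals.

Set Implicit Arguments.
Unset Strict Implicit.
Unset Printing Implicit Defensive.

Import Order.TTheory GRing.Theory Num.Theory.
Local Open Scope ring_scope.

Definition tensor3 (R : Type) (d chi : nat) := 'I_d -> 'I_d -> 'I_chi -> R.
Definition tensor4 (R : Type) (d : nat) := 'I_d -> 'I_d -> 'I_d -> 'I_d -> R.

Definition reflection_l1 (R : Type) (d : nat) (A : tensor4 R d) : Prop :=
  forall i j k l, A i j k l = A k l i j.

Definition reflection_l2 (R : Type) (d : nat) (A : tensor4 R d) : Prop :=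
  forall i j k l, A i j k l = A j i l k.

(* Inverse of mxvec_index: the pair of legs (i, j) packed in a flat index. *)
Definition legs (d : nat) (p : 'I_(d * d)) : 'I_d * 'I_d :=
  enum_val (cast_ord (esym (mxvec_cast d d)) p).

Definition tensor_mx (R : Type) (d : nat) (A : tensor4 R d) : 'M[R]_(d * d) :=
  \matrix_(p, q) A (legs p).1 (legs p).2 (legs q).1 (legs q).2.

Lemma legsK (d : nat) (i j : 'I_d) : legs (mxvec_index i j) = (i, j).
Proof. by rewrite /legs /mxvec_index cast_ordK enum_rankK. Qed.

Lemma tensor_mxE (R : Type) (d : nat) (A : tensor4 R d) (i j k l : 'I_d) :
  tensor_mx A (mxvec_index i j) (mxvec_index k l) = A i j k l.
Proof. by rewrite mxE !legsK. Qed.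

(* The eigenvectors are the columns of V; being n orthonormal vectors of R^n,
   they form a basis. *)
Definition ordered_eigenbasis (R : realType) (n : nat)
    (M V : 'M[R]_n) (lam : 'I_n -> R) : Prop :=
  [/\ V^T *m V = 1%:M,
      forall a, M *m col a V = lam a *: col a V
    & forall a b : 'I_n, (a <= b)%N -> `|lam b| <= `|lam a| ].

Definition v_Lambda (R : realType) (d chi : nat) (hchi : (chi <= d ^ 2)%N)
    (V : 'M[R]_(d * d)) (lam : 'I_(d * d) -> R) : tensor3 R d chi :=
  fun i j a => V (mxvec_index i j) (widen_ord hchi a)
               * Num.sqrt `|lam (widen_ord hchi a)|.

(* Num.sg 0 = 0; the sign given to a zero eigenvalue is immaterial, since the
   corresponding slice of v_Lambda vanishes. *)
Definition sign_Lambda (R : realType) (d chi : nat) (hchi : (chi <= d ^ 2)%N)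
    (lam : 'I_(d * d) -> R) : 'M[R]_chi :=
  diag_mx (\row_a Num.sg (lam (widen_ord hchi a))).

(* The splitting is not unique: any ordered orthonormal eigenbasis yields one.
   It represents the truncated tensor
   (i, j, k, l) |-> \sum_a v i j a * sigma a a * v k l a. *)
Definition symmetric_svd_splitting (R : realType) (d chi : nat)
    (hchi : (chi <= d ^ 2)%N) (A : tensor4 R d)
    (v : tensor3 R d chi) (sigma : 'M[R]_chi) : Prop :=
  exists (V : 'M[R]_(d * d)) (lam : 'I_(d * d) -> R),
    [/\ ordered_eigenbasis (tensor_mx A) V lam,
        v = v_Lambda hchi V lam
      & sigma = sign_Lambda hchi lam].

(* Main.v *)
(* The permutation matrix P that swaps the two legs (i, j) is a symmetric
   involution, and reflection along l_2 says that it commutes with the real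
   symmetric matrix M of A.  Hence M and P have a common orthonormal
   eigenbasis, whose P-eigenvalues are signs; sorting it by the absolute values
   of the M-eigenvalues gives the splitting, and the P-eigenvalues are the
   diagonal of g.

   A common complex eigenvector of two commuting real symmetric matrices has
   real eigenvalues, so its real and imaginary parts are again common
   eigenvectors (or zero); a Householder reflection splits such a vector off,
   and one inducts on the dimension. *)
Require Import Defs.
From mathcomp Require Import all_boot all_order all_algebra.
From mathcomp Require Import reals fingroup perm complex ring lra.

Set Implicit Arguments.
Unset Strict Implicit.
Unset Printing Implicit Defensive.

Import Order.TTheory GRing.Theory Num.Theory.
Local Open Scope ring_scope.

(** * Common real eigenvectors of commuting symmetric matrices *)

Lemma trmx_mx11 (R : nzRingType) (M : 'M[R]_1) : M^T = M.
Proof. by rewrite [M]mx11_scalar tr_scalar_mx. Qed.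

Lemma mul_tr_rV_ge0 (R : realDomainType) n (x : 'rV[R]_n) : 0 <= (x *m x^T) 0 0.
Proof. by rewrite mxE sumr_ge0 // => i _; rewrite mxE -expr2 sqr_ge0. Qed.

Lemma mul_tr_rV_eq0 (R : realDomainType) n (x : 'rV[R]_n) :
  ((x *m x^T) 0 0 == 0) = (x == 0).
Proof.
apply/eqP/eqP => [|->]; last by rewrite mul0mx mxE.
rewrite mxE => /psumr_eq0P h; apply/rowP => i; rewrite mxE.
have /eqP : x 0 i * x^T i 0 = 0.
  by apply: h => // j _; rewrite mxE -expr2 sqr_ge0.
by rewrite mxE mulf_eq0 orbb => /eqP.
Qed.

(** The hypotheses are the real and imaginary parts of [(x + iy) A = (p + iq) (x + iy)]. Evaluating
    the number [x A y^T = y A x^T] in both ways leaves [q (|x|^2 + |y|^2) = 0]. *)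
Lemma symmx_eigen_real (R : realFieldType) n (A : 'M[R]_n) (x y : 'rV_n) p q :
  A^T = A -> x *m A = p *: x - q *: y -> y *m A = q *: x + p *: y ->
  (x != 0) || (y != 0) -> q = 0.
Proof.
move=> symA xA yA nz.
have exy : x *m A *m y^T = y *m A *m x^T.
  by rewrite -[LHS]trmx_mx11 !trmx_mul trmxK symA mulmxA.
have exy' : x *m y^T = y *m x^T by rewrite -[LHS]trmx_mx11 trmx_mul trmxK.
have /eqP : q * ((x *m x^T) 0 0 + (y *m y^T) 0 0) = 0.
  move: exy; rewrite xA yA mulmxBl mulmxDl -!scalemxAl exy'.
  move: (x *m x^T) (y *m y^T) (y *m x^T) => X Y Z.
  by move/matrixP/(_ 0 0); rewrite !mxE; lra.
rewrite mulf_eq0 paddr_eq0 ?mul_tr_rV_ge0 // !mul_tr_rV_eq0 => /orP[/eqP//|].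
by case/andP => xz yz; rewrite xz yz in nz.
Qed.

Lemma map_Re_mul (R : rcfType) n (w : 'rV[R[i]]_n) (A : 'M[R]_n) :
  map_mx (@complex.Re R) (w *m map_mx (real_complex R) A)
    = map_mx (@complex.Re R) w *m A.
Proof.
apply/rowP => k; rewrite !mxE (raddf_sum (@complex.Re R : Rcomplex R -> R)).
by apply: eq_bigr => j _; rewrite !mxE; case: (w 0 j) => a b /=; ring.
Qed.

Lemma map_Im_mul (R : rcfType) n (w : 'rV[R[i]]_n) (A : 'M[R]_n) :
  map_mx (@complex.Im R) (w *m map_mx (real_complex R) A)
    = map_mx (@complex.Im R) w *m A.
Proof.
apply/rowP => k; rewrite !mxE (raddf_sum (@complex.Im R : Rcomplex R -> R)).
by apply: eq_bigr => j _; rewrite !mxE; case: (w 0 j) => a b /=; ring.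
Qed.

Lemma symmx_complex_eigen (R : rcfType) n (A : 'M[R]_n) (w : 'rV[R[i]]_n) a :
  A^T = A -> w != 0 -> w *m map_mx (real_complex R) A = a *: w ->
  map_mx (@complex.Re R) w *m A = complex.Re a *: map_mx (@complex.Re R) w /\
  map_mx (@complex.Im R) w *m A = complex.Re a *: map_mx (@complex.Im R) w.
Proof.
move=> symA w0 wA.
have reA : map_mx (@complex.Re R) w *m A = complex.Re a *:
    map_mx (@complex.Re R) w - complex.Im a *: map_mx (@complex.Im R) w.
  rewrite -map_Re_mul wA; apply/rowP => k; rewrite !mxE.
  by case: a {wA} (w 0 k) => [a b] [c e] /=.
have imA : map_mx (@complex.Im R) w *m A = complex.Im a *:
    map_mx (@complex.Re R) w + complex.Re a *: map_mx (@complex.Im R) w.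
  rewrite -map_Im_mul wA; apply/rowP => k; rewrite !mxE.
  by case: a {wA reA} (w 0 k) => [a b] [c e] /=; ring.
have im0 : complex.Im a = 0.
  apply: symmx_eigen_real symA reA imA _.
  rewrite -negb_and; apply: contra w0 => /andP[/eqP/rowP rw0 /eqP/rowP iw0].
  apply/eqP/rowP => k; have := rw0 k; have := iw0 k; rewrite !mxE.
  by case: (w 0 k) => /= ? ? -> ->.
by rewrite reA imA im0 !scale0r subr0 add0r.
Qed.

Lemma symmx_common_eigenvector (R : rcfType) n (A B : 'M[R]_n) :
  (0 < n)%N -> A^T = A -> B^T = B -> A *m B = B *m A ->
  exists v : 'rV_n, exists a b,
    [/\ v *m v^T = 1%:M, v *m A = a *: v & v *m B = b *: v].
Proof.
move=> n_gt0 symA symB AB.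
have ABC : map_mx (real_complex R) A *m map_mx (real_complex R) B =
           map_mx (real_complex R) B *m map_mx (real_complex R) A.
  by rewrite -!map_mxM AB.
have [w w0 /andP[/sub_rVP[a wA] /sub_rVP[b wB]]] :=
  common_eigenvector2 n_gt0 ABC.
have [reA imA] := symmx_complex_eigen symA w0 wA.
have [reB imB] := symmx_complex_eigen symB w0 wB.
have [u [u0 uA uB]] : exists u : 'rV_n,
    [/\ u != 0, u *m A = complex.Re a *: u & u *m B = complex.Re b *: u].
  (* The same part of [w], whichever is nonzero, serves for both [A] and [B]. *)
  have [rw0|] := eqVneq (map_mx (@complex.Re R) w) 0; last first.
    by exists (map_mx (@complex.Re R) w).
  exists (map_mx (@complex.Im R) w); split=> //.
  apply: contra w0 => /eqP/rowP iw0.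
  apply/eqP/rowP => k; have := congr1 (fun M : 'rV_n => M 0 k) rw0.
  have := iw0 k; rewrite !mxE.
  by case: (w 0 k) => /= ? ? -> ->.
have N0 : 0 < (u *m u^T) 0 0 by rewrite lt_def mul_tr_rV_eq0 u0 mul_tr_rV_ge0.
exists ((Num.sqrt ((u *m u^T) 0 0))^-1 *: u), (complex.Re a), (complex.Re b).
split; rewrite -?scalemxAl ?uA ?uB; first 1 last.
- by rewrite scalerA mulrC -scalerA.
- by rewrite scalerA mulrC -scalerA.
rewrite linearZ /= -scalemxAr scalerA -expr2 exprVn sqr_sqrtr ?ltW //.
by rewrite {2}[u *m u^T]mx11_scalar scale_scalar_mx mulVf // gt_eqF.
Qed.

(** * Orthogonal deflation and simultaneous diagonalization *)

(* H is the Householder reflection exchanging the unit vectors e_0 and v. *)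
Lemma householder (R : realFieldType) n (v : 'rV[R]_n.+1) :
  v *m v^T = 1%:M ->
  exists H : 'M_n.+1, [/\ H^T = H, H *m H = 1%:M & delta_mx 0 0 *m H = v].
Proof.
move=> vv; pose e : 'rV[R]_n.+1 := delta_mx 0 0; pose u := v - e.
have [u0|u0] := eqVneq u 0.
  exists 1%:M; rewrite trmx1 !mulmx1; split=> //.
  by apply/esym/eqP; rewrite -subr_eq0; apply/eqP.
have ee : e *m e^T = 1%:M.
  by rewrite /e trmx_delta mul_delta_mx; apply/matrixP => i j;
     rewrite !mxE !ord1.
have ev : e *m v^T = v *m e^T by rewrite -[LHS]trmx_mx11 trmx_mul trmxK.
pose c := (u *m u^T) 0 0.
have uuE : u *m u^T = c%:M by rewrite [LHS]mx11_scalar.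
have c0 : c != 0 by rewrite mul_tr_rV_eq0.
(* Since [e] and [v] are unit vectors, [|u|^2 = 2 - 2 <e, v>], while [<e, u> = <e, v> - 1]. *)
have euE : e *m u^T = (- (c / 2))%:M.
  have h : 2%:R *: (e *m u^T) = - (u *m u^T).
    rewrite /u linearB /= !mulmxBl !mulmxBr vv ee ev.
    rewrite scalerBr !scaler_nat !mulr2n.
    by apply/matrixP => i j; rewrite !mxE; ring.
  apply: (@scalerI _ _ 2%:R); rewrite ?pnatr_eq0 // h uuE.
  by apply/matrixP => i j; rewrite !mxE !ord1 !mulr1n; field.
(* [K] is twice the orthogonal projection onto the line of [u]; hence [K^2 = 2K], and [1 - K] is an
   involution. *)
pose K := (2 / c) *: (u^T *m u).
have KK : K *m K = K + K.
  rewrite /K -scalemxAl -scalemxAr mulmxA -(mulmxA u^T) uuE.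
  by rewrite mul_mx_scalar -scalemxAl !scalerA -scalerDl; congr (_ *: _); field.
exists (1%:M - K); split.
- by rewrite linearB /= trmx1 linearZ /= trmx_mul trmxK.
- by rewrite mulmxBl mul1mx mulmxBr mulmx1 KK opprB addrK subrK.
rewrite mulmxBr mulmx1 -scalemxAr mulmxA euE mul_scalar_mx scalerA.
have -> : 2 / c * - (c / 2) = -1 by field.
by rewrite scaleN1r opprK /u addrC subrK.
Qed.

(** The common eigenvectors are the rows of [Q], since the eigenvectors above are row vectors. *)
Lemma symmx_codiag (R : rcfType) n (A B : 'M[R]_n) :
  A^T = A -> B^T = B -> A *m B = B *m A ->
  exists Q : 'M_n, exists a b : 'rV_n,
    [/\ Q *m Q^T = 1%:M, Q *m A = diag_mx a *m Q & Q *m B = diag_mx b *m Q].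
Proof.
elim: n A B => [|n IH] A B symA symB AB.
  by exists 0, 0, 0; split; apply/matrixP; case.
have [v [a [b [vv vA vB]]]] := symmx_common_eigenvector (ltn0Sn n) symA symB AB.
have [H [symH HH eH]] := householder vv.
(* As [H] exchanges [e_0] and [v], the first row of [H M H] is [m e_0]; symmetry then clears the
   first column as well. *)
have deflate (M : 'M[R]_n.+1) m : M^T = M -> v *m M = m *: v ->
    exists2 M' : 'M_n, M'^T = M' &
      H *m M *m H = block_mx (m%:M : 'M_1) 0 0 M' :> 'M_(1 + n).
  move=> symM vM; pose N : 'M_(1 + n) := H *m M *m H.
  have symN : N^T = N by rewrite /N !trmx_mul symH symM mulmxA.
  have rN : usubmx N = row_mx m%:M 0.
    have -> : usubmx N = row 0 N.
      apply/rowP => j; rewrite [LHS]mxE [RHS]mxE.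
      by congr (N _ j); apply/val_inj.
    rewrite rowE /N !mulmxA eH vM -scalemxAl -eH -mulmxA HH mulmx1.
    apply/rowP => j; rewrite !mxE eqxx /=.
    case: (split_ordP j) => k ->; rewrite !mxE ?ord1.
      by rewrite !eqxx mulr1.
    by rewrite mulr0.
  exists (drsubmx N); first by rewrite trmx_drsub symN.
  rewrite -/N -[LHS]submxK; congr block_mx.
  - by rewrite /ulsubmx rN row_mxKl.
  - by rewrite /ursubmx rN row_mxKr.
  - by rewrite -[LHS]trmxK trmx_dlsub symN /ursubmx rN row_mxKr trmx0.
have [A' symA' EA] := deflate A a symA vA.
have [B' symB' EB] := deflate B b symB vB.
(* Conjugation by the involution [H] preserves commutation; compare the lower right blocks. *)
have AB' : A' *m B' = B' *m A'.
  have : block_mx (a%:M : 'M_1) 0 0 A' *m block_mx (b%:M : 'M_1) 0 0 B' =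
         block_mx (b%:M : 'M_1) 0 0 B' *m block_mx (a%:M : 'M_1) 0 0 A'.
    rewrite -EA -EB -!mulmxA !(mulmxA H H) HH !mul1mx.
    by rewrite (mulmxA A B) (mulmxA B A) AB.
  rewrite !mulmx_block => /eq_block_mx[_ _ _].
  by rewrite !mul0mx !add0r.
have [Q [al [be [QQ QA QB]]]] := IH A' B' symA' symB' AB'.
pose K : 'M_(1 + n) := block_mx 1%:M 0 0 Q.
(* [K] diagonalizes the deflated matrix and leaves [e_0] fixed, so [K H] diagonalizes the original
   one. *)
have lift M M' m mu : H *m M *m H = block_mx (m%:M : 'M_1) 0 0 M' ->
    Q *m M' = diag_mx mu *m Q ->
    K *m H *m M = diag_mx (row_mx (m%:M : 'M_1) mu) *m (K *m H).
  move=> EM QM.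
  have -> : K *m H *m M = K *m (H *m M *m H) *m H.
    by rewrite -!mulmxA HH mulmx1.
  have EK : K *m block_mx (m%:M : 'M_1) 0 0 M' =
            diag_mx (row_mx (m%:M : 'M_1) mu) *m K.
    rewrite /K diag_mx_row !mulmx_block !mul0mx !mulmx0 !mul1mx !mulmx1.
    rewrite !addr0 !add0r QM; congr block_mx.
    by apply/matrixP => i j; rewrite !mxE !ord1.
  by rewrite EM mulmxA; apply: (congr1 (mulmx^~ H) EK).
have KK : K *m K^T = 1%:M.
  rewrite /K tr_block_mx !trmx0 mulmx_block !mul0mx !mulmx0 !addr0 !add0r.
  by rewrite trmx1 mulmx1 QQ -scalar_mx_block.
exists (K *m H), (row_mx (a%:M : 'M_1) al), (row_mx (b%:M : 'M_1) be); split.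
- by rewrite trmx_mul symH mulmxA -(mulmxA K) HH mulmx1.
- exact: lift EA QA.
- exact: lift EB QB.
Qed.

(** * Ordering the eigenvalues and swapping the legs *)

Lemma sort_perm (R : realDomainType) n (f : 'I_n -> R) :
  exists s : 'S_n, forall a b : 'I_n, (a <= b)%N -> f (s b) <= f (s a).
Proof.
pose r i j := f j <= f i.
have r_tr : transitive r by move=> j i k ij jk; apply: le_trans jk ij.
have r_refl : reflexive r by move=> i; apply: lexx.
(* The indices are sorted rather than the values: they are distinct even when [f] has ties, so the
   sorted tuple is a permutation. *)
pose t := sort_tuple r (ord_tuple n).
have t_inj : injective (tnth t).
  by apply/tuple_uniqP; rewrite /= sort_uniq enum_uniq.
exists (perm t_inj) => a b ab; rewrite !permE !(tnth_nth a).
by apply: (sorted_leq_nth r_tr r_refl) => //;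
  rewrite ?inE ?size_tuple // sort_sorted // => i j; apply: le_total.
Qed.

Definition swap_legs d (p : 'I_(d * d)) := mxvec_index (legs p).2 (legs p).1.

Lemma swap_legsK d : involutive (@swap_legs d).
Proof.
move=> p; rewrite /swap_legs legsK /=.
by case/mxvec_indexP: p => i j; rewrite legsK.
Qed.

Definition swap_perm d : 'S_(d * d) := perm (inv_inj (@swap_legsK d)).

Lemma swap_permV d : ((swap_perm d)^-1 = swap_perm d)%g.
Proof.
apply/eqP; rewrite eq_invg_mul; apply/eqP/permP => p.
by rewrite permM !permE swap_legsK.
Qed.

Lemma swap_permE d (i j : 'I_d) :
  swap_perm d (mxvec_index i j) = mxvec_index j i.
Proof. by rewrite permE /swap_legs legsK. Qed.

Theorem theorem1 (R : realType) (d chi : nat) (hd : (1 <= d)%N)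
    (A : tensor4 R d) (hA1 : reflection_l1 A) (hA2 : reflection_l2 A)
    (hchi1 : (1 <= chi)%N) (hchi : (chi <= d ^ 2)%N) :
  exists (v : tensor3 R d chi) (sigma : 'M[R]_chi),
    symmetric_svd_splitting hchi A v sigma /\
    exists g : 'M[R]_chi,
      [/\ is_diag_mx g,
          forall a, g a a = 1 \/ g a a = -1
        & forall i j a, v j i a = v i j a * g a a].
Proof.
pose M := tensor_mx A; pose P : 'M[R]_(d * d) := perm_mx (swap_perm d).
have symM : M^T = M by apply/matrixP => p q; rewrite !mxE hA1.
have symP : P^T = P by rewrite tr_perm_mx swap_permV.
have PP : P *m P = 1%:M.
  by rewrite -perm_mxM -{1}swap_permV mulVg perm_mx1.
have MP : M *m P = P *m M.
  (* Left multiplication by a permutation matrix permutes rows, right multiplication permutes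
     columns by the inverse; the swap is its own inverse. Entrywise the claim is then the [l_2]
     reflection. *)
  rewrite -row_permE /P -[in LHS]swap_permV -col_permE.
  apply/matrixP => p q; rewrite !mxE !permE /swap_legs !legsK /=.
  exact: hA2.
have [Q [l [b [QQ QM QP]]]] := symmx_codiag symM symP MP.
(* [diag_mx b] is [Q P Q^T], whose square is the identity because [P] is an involution. *)
have b_sign k : b 0 k = 1 \/ b 0 k = -1.
  have : diag_mx b *m diag_mx b = 1%:M.
    by rewrite -[LHS]mulmx1 -QQ !mulmxA -(mulmxA _ _ Q) -QP mulmxA -QP
               -!mulmxA (mulmxA P) PP mul1mx.
  rewrite mul_diag_mx => /matrixP/(_ k k); rewrite !mxE eqxx mulr1n -expr2.
  by move/eqP; rewrite sqrf_eq1 => /orP[]/eqP; [left|right].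
have [s s_sort] := sort_perm (fun k => `|l 0 k|).
pose V := (row_perm s Q)^T; pose lam k := l 0 (s k).
have VE p k : V p k = Q (s k) p by rewrite !mxE.
(* This is the entry of [Q P = diag(b) Q] in row [s k] and column [(i, j)]: right multiplication by
   [P] swaps the legs of the column index. *)
have Vswap i j k :
    V (mxvec_index j i) k = V (mxvec_index i j) k * b 0 (s k).
  rewrite !VE mulrC; have /matrixP/(_ (s k) (mxvec_index i j)) := QP.
  rewrite mul_diag_mx /P -swap_permV -col_permE [LHS]mxE swap_permE.
  by rewrite [RHS]mxE.
exists (v_Lambda hchi V lam), (sign_Lambda hchi lam); split.
  exists V, lam; split=> //; split.
  - rewrite /V trmxK row_permE trmx_mul mulmxA -(mulmxA _ Q) QQ mulmx1.
    by rewrite tr_perm_mx -perm_mxM mulgV perm_mx1.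
  (* Transposing the row relation [Q M = diag(l) Q] gives column eigenvectors because [M] is
     symmetric. *)
  - move=> k; have -> : col k V = (row (s k) Q)^T.
      by apply/colP => p; rewrite !mxE.
    rewrite -[tensor_mx A]symM -trmx_mul -row_mul QM -linearZ /=.
    by congr _^T; apply/rowP => q; rewrite mul_diag_mx !mxE.
  - by move=> k k' kk'; apply: s_sort.
(* The signs of the retained eigenvectors, in sorted order; the factor [sqrt |lam|] depends only on
   the bond index, so it does not affect the swap. *)
exists (diag_mx (\row_k b 0 (s (widen_ord hchi k)))); split.
- exact: diag_mx_is_diag.
- by move=> k; rewrite !mxE eqxx mulr1n.
- by move=> i j k; rewrite /v_Lambda Vswap !mxE eqxx mulr1n mulrAC.
Qed.
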